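(* Let $X$ be a normal modal logic and let $I$ be an index set with $\omega\subseteq I$. Suppose that $X$ is complete with respect to a set of Kripke frames $F=\{(G_\alpha,R_\alpha):\alpha\in I\}$, where for every $\alpha\in I$, $G_\alpha$ is a nonempty infinite set and $R_\alpha$ is an accessibility relation (a binary relation) on $G_\alpha$. Let $H=\{(G_i^*,R_i^* ): i\in\omega\}$ be a set of Kripke frames such that for every $i\in\omega$: $$G_i^*=\{*,g_0,g_1,\dots,g_i\}\cup G_{\omega i},$$ where $G_{\omega i}=\{\eta_{ij}: j\in\omega\}$ has cardinality $\aleph_0$, $\{*,g_0,\dots,g_i\}\cap G_{\omega i}=\emptyset$, the elements $*,g_0,\dots,g_i$ are distinct, and $$R_i^*=\{( *,g_j):0\le j\le i\}\cup\{(g_j,g_j): 1\le j\le i\}\cup\{(\eta,\eta):\eta\in G_{\omega i}\}.$$ If $H\subseteq F$, then $B$-translation is faithful with respect to $X$.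
   Context: The system $\mathbf{L_1}$ (Leśniewski's propositional ontology): fix a countably infinite set of name variables. The atomic formulas are exactly the expressions $\epsilon ab$ with $a,b$ name variables (possibly equal); formulas are built from atomic formulas by $\vee$ and $\neg$, the other connectives being the usual classical abbreviations. $\mathbf{L_1}$ is a Hilbert-style system of classical propositional logic (with modus ponens) over these formulas with the additional axiom schemata, for all name variables $a,b,c$: (Ax1) $\epsilon ab \supset \epsilon aa$; (Ax2) $(\epsilon ab \wedge \epsilon bc) \supset \epsilon ac$; (Ax3) $(\epsilon ab \wedge \epsilon bc) \supset \epsilon ba$. $B$-translation: to each name variable $a$ corresponds a propositional variable $p_a$, with distinct name variables corresponding to distinct propositional variables. $B$ maps formulas of $\mathbf{L_1}$ to propositional modal formulas by $B(\phi\vee\psi)=B(\phi)\vee B(\psi)$, $B(\neg\phi)=\neg B(\phi)$, $B(\epsilon ab)=p_a\wedge\Box(p_a\supset p_b)\wedge\bigl(p_b\supset\Box(p_b\supset p_a)\bigr)$. $B$-translation is faithful with respect to a modal logic $X$ if for every formula $\phi$ of $\mathbf{L_1}$, $\vdash_X B(\phi)$ implies $\vdash_{\mathbf{L_1}}\phi$. A normal modal logic is a set $X$ of propositional modal formulas with $\mathbf{K}\subseteq X$ that is closed under modus ponens, substitution and necessitation. $X$ is complete with respect to a set $F$ of Kripke frames if, for every modal formula $\chi$, $\vdash_X\chi$ holds if and only if $\chi$ is valid in every frame in $F$. *)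

(* Defs.v *)
From mathcomp Require Import all_boot.
From mathcomp Require Import boolp classical_sets functions cardinality.

Set Implicit Arguments.
Unset Strict Implicit.
Unset Printing Implicit Defensive.

Local Open Scope classical_set_scope.

(* Name variables and propositional variables are both indexed by nat. *)

Inductive lform : Type :=
| Eps : nat -> nat -> lform
| LOr : lform -> lform -> lform
| LNot : lform -> lform.

Definition LImp (A B : lform) : lform := LOr (LNot A) B.
Definition LAnd (A B : lform) : lform := LNot (LOr (LNot A) (LNot B)).

(* The propositional basis is the Hilbert-Ackermann axiomatization, which is
   complete for the primitives "or" and "not" with modus ponens. *)
Inductive L1 : lform -> Prop :=
| L1_taut A : L1 (LImp (LOr A A) A)
| L1_add A B : L1 (LImp A (LOr A B))
| L1_perm A B : L1 (LImp (LOr A B) (LOr B A))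
| L1_sum A B C : L1 (LImp (LImp B C) (LImp (LOr A B) (LOr A C)))
| L1_ax1 a b : L1 (LImp (Eps a b) (Eps a a))
| L1_ax2 a b c : L1 (LImp (LAnd (Eps a b) (Eps b c)) (Eps a c))
| L1_ax3 a b c : L1 (LImp (LAnd (Eps a b) (Eps b c)) (Eps b a))
| L1_mp A B : L1 (LImp A B) -> L1 A -> L1 B.

Inductive mform : Type :=
| PVar : nat -> mform
| MOr : mform -> mform -> mform
| MNot : mform -> mform
| Box : mform -> mform.

Definition MImp (A B : mform) : mform := MOr (MNot A) B.
Definition MAnd (A B : mform) : mform := MNot (MOr (MNot A) (MNot B)).

Fixpoint msubst (s : nat -> mform) (A : mform) : mform :=
  match A with
  | PVar n => s n
  | MOr A B => MOr (msubst s A) (msubst s B)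
  | MNot A => MNot (msubst s A)
  | Box A => Box (msubst s A)
  end.

(* Axioms are schemata, so no substitution rule is needed here. *)
Inductive K : mform -> Prop :=
| K_taut A : K (MImp (MOr A A) A)
| K_add A B : K (MImp A (MOr A B))
| K_perm A B : K (MImp (MOr A B) (MOr B A))
| K_sum A B C : K (MImp (MImp B C) (MImp (MOr A B) (MOr A C)))
| K_dist A B : K (MImp (Box (MImp A B)) (MImp (Box A) (Box B)))
| K_mp A B : K (MImp A B) -> K A -> K B
| K_nec A : K A -> K (Box A).

Definition normal_logic (X : set mform) : Prop :=
  [/\ K `<=` X,
      forall A B, X (MImp A B) -> X A -> X B,
      forall s A, X A -> X (msubst s A)
    & forall A, X A -> X (Box A)].

Fixpoint Btrans (p : nat -> nat) (A : lform) : mform :=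
  match A with
  | Eps a b =>
      let pa := PVar (p a) in
      let pb := PVar (p b) in
      MAnd (MAnd pa (Box (MImp pa pb))) (MImp pb (Box (MImp pb pa)))
  | LOr A B => MOr (Btrans p A) (Btrans p B)
  | LNot A => MNot (Btrans p A)
  end.

Definition Bfaithful (p : nat -> nat) (X : set mform) : Prop :=
  forall A : lform, X (Btrans p A) -> L1 A.

(* Frames are sets of points of an ambient type U, so that equality of frames,
   and hence inclusion between sets of frames, is meant literally. *)
Record frame (U : Type) : Type :=
  Frame { worlds : set U; acc : set (U * U) }.

Definition is_frame (U : Type) (f : frame U) : Prop :=
  worlds f !=set0 /\ acc f `<=` worlds f `*` worlds f.

(* Only the trace of the valuation V on [worlds f] matters when
   [is_frame f] holds. *)
Fixpoint sat (U : Type) (f : frame U) (V : nat -> set U) (w : U)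
    (A : mform) : Prop :=
  match A with
  | PVar n => V n w
  | MOr A B => sat f V w A \/ sat f V w B
  | MNot A => ~ sat f V w A
  | Box A => forall v, acc f (w, v) -> sat f V v A
  end.

Definition valid (U : Type) (f : frame U) (A : mform) : Prop :=
  forall (V : nat -> set U) (w : U), worlds f w -> sat f V w A.

Definition complete_wrt (U : Type) (X : set mform) (F : set (frame U)) : Prop :=
  forall A : mform, X A <-> (forall f, F f -> valid f A).

Section StarFrames.
Variables (U : Type) (star : U) (g : nat -> U) (eta : nat -> nat -> U).

Definition star_part (i : nat) : set U := star |` [set g j | j in `I_i.+1].

Definition star_points_ok (i : nat) : Prop :=
  [/\ set_inj `I_i.+1 g,
      ~ [set g j | j in `I_i.+1] star,
      (range (eta i) #= [set: nat])%card
    & star_part i `&` range (eta i) = set0].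

(* The point g 0 is seen by star but, unlike the other g j, is irreflexive. *)
Definition star_frame (i : nat) : frame U :=
  Frame (star_part i `|` range (eta i))
        ([set (star, g j) | j in [set j | j <= i]] `|`
         [set (g j, g j) | j in [set j | 1 <= j <= i]] `|`
         [set (x, x) | x in range (eta i)]).

End StarFrames.

(* Main.v *)
Require Import Defs.
From mathcomp Require Import all_boot.
From mathcomp Require Import boolp classical_sets functions cardinality.

Local Open Scope classical_set_scope.

Set Implicit Arguments.

(** A non-theorem of L1 is refuted by a maximal theory M; write [E a b] for
    [M (Eps a b)].  On a star frame with enough points g k, let p_a hold at star
    iff [E a a], and at g k iff [E k a].  Then B(eps a b) holds at star iff
    [E a b]: from left to right, p_a is true at g a as [E a a], hence so is p_b;
    from right to left one uses the three axioms of L1.  So star refutes the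
    translation of the non-theorem. *)

(** Derivations are carried out in an arbitrary theory, so that they also serve for the extensions
    formed in the Lindenbaum argument. *)
Definition L1_theory (T : set lform) : Prop :=
  L1 `<=` T /\ forall A B, T (LImp A B) -> T A -> T B.

Section Theory.
Variables (T : set lform) (T_th : L1_theory T).
Implicit Types A B C : lform.

Lemma theory_L1 {A} : L1 A -> T A.
Proof. exact: T_th.1. Qed.

Lemma theory_mp {A B} : T (LImp A B) -> T A -> T B.
Proof. exact: T_th.2. Qed.

Lemma theory_trans {A B C} : T (LImp A B) -> T (LImp B C) -> T (LImp A C).
Proof.
move=> AB BC.
exact: theory_mp (theory_mp (theory_L1 (L1_sum (LNot A) B C)) BC) AB.
Qed.

Lemma theory_refl A : T (LImp A A).
Proof.
exact: theory_trans (theory_L1 (L1_add A A)) (theory_L1 (L1_taut A)).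
Qed.

Lemma theory_orl A B : T (LImp A (LOr A B)).
Proof. exact: theory_L1 (L1_add A B). Qed.

Lemma theory_orr A B : T (LImp B (LOr A B)).
Proof. exact: theory_trans (theory_orl B A) (theory_L1 (L1_perm B A)). Qed.

Lemma theory_or_elim {A B C} :
  T (LImp A C) -> T (LImp B C) -> T (LImp (LOr A B) C).
Proof.
move=> AC BC.
have h1 : T (LImp (LOr A B) (LOr C A)).
  exact: theory_trans (theory_mp (theory_L1 (L1_sum A B C)) BC)
    (theory_L1 (L1_perm A C)).
have h2 := theory_mp (theory_L1 (L1_sum C A C)) AC.
exact: theory_trans h1 (theory_trans h2 (theory_L1 (L1_taut C))).
Qed.

Lemma theory_weaken {A B} : T B -> T (LImp A B).
Proof. exact: theory_mp (theory_orr (LNot A) B). Qed.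

Lemma theory_imp_mp {A B C} :
  T (LImp A (LImp B C)) -> T (LImp A B) -> T (LImp A C).
Proof.
move=> ABC AB.
(* Exchange of premises; chaining with [AB] then leaves a doubled [A], which is contracted. *)
have BAC : T (LImp B (LImp A C)).
  apply: theory_mp ABC; apply: theory_or_elim.
    exact: theory_trans (theory_orl (LNot A) C) (theory_orr _ _).
  exact: theory_mp (theory_L1 (L1_sum (LNot B) C _)) (theory_orr _ _).
apply: theory_mp (theory_trans AB BAC).
exact: theory_or_elim (theory_orl _ _) (theory_refl _).
Qed.

(** This replaces the deduction theorem: the set is the least theory containing [T] and [A]. *)
Lemma theory_assume A : L1_theory [set B | T (LImp A B)].
Proof.
by split=> [B /theory_L1 /theory_weaken|B C]; [exact|exact: theory_imp_mp].
Qed.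

End Theory.

Definition truth_set (M : set lform) : Prop :=
  (forall A, M (LNot A) <-> ~ M A) /\
  (forall A B, M (LOr A B) <-> M A \/ M B).

(** By Zorn there is a maximal theory omitting [A]. It contains [LImp B A] for every [B] outside it,
    and this decides negations and disjunctions. *)
Lemma lindenbaum A : ~ L1 A ->
  exists M, [/\ L1_theory M, ~ M A & truth_set M].
Proof.
move=> nA.
(* The union with L1 lets the empty chain satisfy the property. *)
pose P := [set G : set lform | L1_theory (L1 `|` G) /\ ~ (L1 `|` G) A].
have [|G [[G_th GA] G_max]] := @Zorn_bigcup _ P.
  move=> Q QP Q_chain; split; last first.
    by case=> // -[G QG GA]; have [_] := QP _ QG; apply; right.
  split=> [B|B C]; first by left.
  (* Modus ponens within one member of the chain; premises from two members both lie in the larger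
     one. *)
  have mpG G : Q G -> (L1 `|` G) (LImp B C) -> (L1 `|` G) B ->
      (L1 `|` \bigcup_(X in Q) X) C.
    move=> QG BC B'; have [G_th _] := QP _ QG.
    by have [|GC] := theory_mp G_th BC B'; [left|right; exists G].
  case=> [BC|[G QG BC]] [B'|[G' QG' B']].
  - by left; exact: L1_mp BC B'.
  - by apply: (mpG G') => //; [left|right].
  - by apply: (mpG G) => //; [right|left].
  - have [GG|GG] := Q_chain _ _ QG QG'.
    + by apply: (mpG G') => //; right=> //; exact: GG.
    + by apply: (mpG G) => //; right=> //; exact: GG.
set M := L1 `|` G in G_th GA.
have M_max B : ~ M B -> M (LImp B A).
  move=> nB; apply: contrapT => nBA.
  (* The consequences of [B] over [M] would form a theory omitting [A] and properly extending [G],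
     since it contains [B]. *)
  have N_th := theory_assume G_th B.
  set N := [set C | M (LImp B C)] in N_th.
  have NE : L1 `|` N = N by apply/setUidPr; exact: N_th.1.
  apply: (G_max N); last by split; rewrite NE.
  split=> [C GC|NG]; first by apply: (theory_weaken G_th); right.
  by apply: nB; right; apply: NG; exact: (theory_refl G_th).
exists M; split=> //; split=> [B|B C]; split.
- move=> nB B'; apply: GA.
  exact: theory_mp (theory_mp G_th (theory_orl G_th _ _) nB) B'.
- move=> nB; apply: contrapT => nnB; apply: GA.
  have BA := theory_or_elim G_th (M_max _ nnB) (M_max _ nB).
  (* [LImp B B] unfolds to [LOr (LNot B) B], the excluded middle. *)
  exact: theory_mp BA (theory_refl G_th B).
- move=> BC; apply: contrapT => /not_orP[nB nC]; apply: GA.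
  exact: theory_mp (theory_or_elim G_th (M_max _ nB) (M_max _ nC)) BC.
- case; first exact: theory_mp (theory_orl G_th _ _).
  exact: theory_mp (theory_orr G_th _ _).
Qed.

Section TruthSet.
Variables (M : set lform) (M_th : L1_theory M) (M_truth : truth_set M).

Lemma truth_and A B : M A -> M B -> M (LAnd A B).
Proof. by move=> MA MB; rewrite /LAnd M_truth.1 M_truth.2 !M_truth.1; case. Qed.

Lemma truth_ax1 {a b} : M (Eps a b) -> M (Eps a a).
Proof. exact: theory_mp (theory_L1 M_th (L1_ax1 a b)). Qed.

Lemma truth_ax2 {a b c} : M (Eps a b) -> M (Eps b c) -> M (Eps a c).
Proof.
move=> ab bc.
exact: theory_mp (theory_L1 M_th (L1_ax2 a b c)) (truth_and ab bc).
Qed.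

Lemma truth_ax3 {a b c} : M (Eps a b) -> M (Eps b c) -> M (Eps b a).
Proof.
move=> ab bc.
exact: theory_mp (theory_L1 M_th (L1_ax3 a b c)) (truth_and ab bc).
Qed.

End TruthSet.

Lemma sat_and {U : Type} (f : frame U) V w A B :
  sat f V w (MAnd A B) <-> sat f V w A /\ sat f V w B.
Proof. by rewrite /= not_orP !notK. Qed.

Lemma sat_imp {U : Type} (f : frame U) V w A B :
  sat f V w (MImp A B) <-> (sat f V w A -> sat f V w B).
Proof. by rewrite /= implyE. Qed.

Fixpoint name_bound (A : lform) : nat :=
  match A with
  | Eps a b => maxn a b
  | LOr A B => maxn (name_bound A) (name_bound B)
  | LNot A => name_bound A
  end.

Section StarModel.
Variables (U : Type) (star : U) (g : nat -> U) (eta : nat -> nat -> U).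
Variable n : nat.
Hypothesis n_ok : star_points_ok star g eta n.
Variables (p : nat -> nat) (p_inj : injective p).
Variables (M : set lform) (M_th : L1_theory M) (M_truth : truth_set M).

Let f := star_frame star g eta n.

Lemma star_neq_g k : k <= n -> star <> g k.
Proof.
by case: n_ok => _ sg _ _ kn E; apply: sg; exists k; rewrite /= ?ltnS.
Qed.

(** As [star] differs from every [g k] with [k <= n] and from every point of [eta n], no reflexive
    arrow starts at it. *)
Lemma acc_star v : acc f (star, v) <-> exists2 k, k <= n & v = g k.
Proof.
split=> [[[[k kn [<-]]|[k /andP[_ kn] [E _]]]|[x xeta [E _]]]|[k kn ->]].
- by exists k.
- by case: (star_neq_g kn).
- case: n_ok => _ _ _ E0; have : set0 star; last by [].
  by rewrite -E0 -{2}E; split=> //; left.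
- by left; left; exists k.
Qed.

(** Since [p] may fail to be surjective, names are reached as preimages; a variable outside the
    range of [p] is false everywhere. *)
Definition star_val (q : nat) : set U :=
  [set w | exists2 a, q = p a &
    (w = star /\ M (Eps a a)) \/
    (exists k, [/\ k <= n, w = g k & M (Eps k a)])].

Lemma star_val_star a : star_val (p a) star <-> M (Eps a a).
Proof.
split=> [[b /p_inj <- [[]//|[k [kn /star_neq_g E]]]]|aa]; first by case: E.
by exists a => //; left.
Qed.

Lemma star_val_g a k : k <= n -> star_val (p a) (g k) <-> M (Eps k a).
Proof.
move=> kn; split=> [[b /p_inj <- [[E]|[j [jn E]]]]|ka].
- by case: (star_neq_g kn).
- case: n_ok => g_inj _ _ _.
  by rewrite (g_inj _ _ _ _ E) // in_setE /= ltnS.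
- by exists a => //; right; exists k.
Qed.

Lemma box_star a b :
  sat f star_val star (Box (MImp (PVar (p a)) (PVar (p b)))) <->
  forall k, k <= n -> M (Eps k a) -> M (Eps k b).
Proof.
split=> [ab k kn|ab v /acc_star[k kn ->]].
  have /sat_imp : sat f star_val (g k) (MImp (PVar (p a)) (PVar (p b))).
    by apply: ab; apply/acc_star; exists k.
  by rewrite /= !star_val_g.
apply/(sat_imp f star_val (g k) (PVar _) (PVar _)).
by rewrite /= !star_val_g //; exact: ab.
Qed.

Lemma sat_star A : name_bound A <= n ->
  sat f star_val star (Btrans p A) <-> M A.
Proof.
elim: A => [a b|A IHA B IHB|A IHA].
- rewrite [name_bound _]/= geq_max => /andP[an bn].
  rewrite [Btrans _ _]/= !sat_and sat_imp !box_star.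
  rewrite ![sat _ _ _ (PVar _)]/= !star_val_star.
  (* The instance [k := a] is available because [a <= n]. *)
  split=> [[[aa ab] _]|ab]; first exact: ab.
  split; first split; first exact: truth_ax1 ab.
    by move=> k _ ka; exact: truth_ax2 ka ab.
  (* (Ax3) with [c := b] gives [M (Eps b a)] from [ab] and [bb]; (Ax2) then passes from [Eps k b] to
     [Eps k a]. *)
  move=> bb k _ kb.
  by exact: (truth_ax2 M_th M_truth kb (truth_ax3 M_th M_truth ab bb)).
- rewrite [name_bound _]/= geq_max => /andP[/IHA {}IHA /IHB {}IHB].
  by rewrite M_truth.2 -IHA -IHB.
- by move=> /IHA {}IHA; rewrite M_truth.1 -IHA.
Qed.

End StarModel.

Unset Implicit Arguments.

Theorem theorem7p2 (U I : Type) (iota : nat -> I) (iota_inj : injective iota)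
    (p : nat -> nat) (p_inj : injective p)
    (X : set mform) (X_normal : normal_logic X)
    (F : I -> frame U)
    (F_frame : forall alpha, is_frame (F alpha))
    (F_infinite : forall alpha, infinite_set (worlds (F alpha)))
    (X_complete : complete_wrt X (range F))
    (star : U) (g : nat -> U) (eta : nat -> nat -> U)
    (H_ok : forall i, star_points_ok star g eta i)
    (H_sub_F : range (star_frame star g eta) `<=` range F) :
  Bfaithful p X.
Proof.
move=> A XA; apply: contrapT => /lindenbaum[M [M_th MA M_truth]]; apply: MA.
(* With this index every name [a] occurring in [A] has its point [g a] in the frame. *)
pose n := name_bound A.
have Ff : range F (star_frame star g eta n) by apply: H_sub_F; exists n.
apply/(sat_star (H_ok n) p_inj M_th M_truth A (leqnn n)).
by apply: ((X_complete _).1 XA _ Ff); left; left.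
Qed.
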